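(* Let $\{a_n\}_{n=1}^\infty$ be a non-decreasing sequence of positive integers such that $\lim_{n\to\infty} a_n^{1/3^n}=\infty$, and let $\{p_n\}_{n=1}^\infty$ be the increasing sequence of all primes. Then the two continued fractions $$\Big[0;a_1\Big(1+\frac{p_1}{1}\Big)\sqrt2,\dots,a_n\Big(1+\frac{p_n}{n}\Big)\sqrt2,\dots\Big],\qquad \Big[0;a_1\frac{p_1}{1}\sqrt2,\dots,a_n\frac{p_n}{n}\sqrt2,\dots\Big]$$ and the number $1$ are linearly independent over $\mathbb{Q}(\sqrt2)$; in particular they are linearly independent over $\mathbb{Q}$.
   Context: For real numbers $x_0$ and $x_1,x_2,\dots\ge 1$, $[x_0;x_1,x_2,\dots]$ denotes the continued fraction $x_0+\cfrac{1}{x_1+\cfrac{1}{x_2+\cdots}}$, i.e. the limit of the finite continued fractions $[x_0;x_1,\dots,x_n]$ as $n\to\infty$; the terms are not required to be integers. *)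

(* Defs.v *)
From HB Require Import structures.
From mathcomp Require Import all_boot all_order all_algebra.
From mathcomp Require Import all_classical all_reals all_analysis.

Set Implicit Arguments.
Unset Strict Implicit.
Unset Printing Implicit Defensive.

Import Order.TTheory GRing.Theory Num.Theory.
Import numFieldNormedType.Exports.

Local Open Scope classical_set_scope.
Local Open Scope ring_scope.

(* [x0; x 1, ..., x n]; the value x 0 is not used. *)
Fixpoint fin_cfrac (R : realType) (x0 : R) (x : nat -> R) (n : nat) : R :=
  if n is m.+1 then x0 + (fin_cfrac (x 1%N) (fun k => x k.+1) m)^-1 else x0.

(* [x0; x 1, x 2, ...]. The value is the default point 0 if the limit does not
   exist, which cannot happen when x k >= 1 for all k >= 1. *)
Definition cfrac (R : realType) (x0 : R) (x : nat -> R) : R :=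
  lim (fin_cfrac x0 x n @[n --> \oo]).

Definition rationals (R : realType) : set R := range (@ratr R).

(* The field Q(x): the smallest subfield of R containing x. Every subfield of R
   contains the rationals. *)
Definition rat_adjoin (R : realType) (x : R) : set R :=
  [set y | forall K : {pred R}, GRing.divring_closed K -> x \in K -> y \in K].

(* R is infinite-dimensional over the subfields of interest, so the predicate
   free on vectType does not apply. *)
Definition lin_indep (R : realType) (K : set R) (n : nat) (v : n.-tuple R) :
    Prop :=
  forall c : 'I_n -> R, (forall i, K (c i)) ->
    \sum_(i < n) c i * tnth v i = 0 -> forall i, c i = 0.

(* Main.v *)
Require Import Defs.
From HB Require Import structures.
From mathcomp Require Import all_boot all_order all_algebra.
From mathcomp Require Import all_classical all_reals all_analysis.
From mathcomp Require Import ring lra zify.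

Set Implicit Arguments.
Unset Strict Implicit.
Unset Printing Implicit Defensive.

Import Order.TTheory GRing.Theory Num.Theory.
Import numFieldNormedType.Exports.

Local Open Scope classical_set_scope.
Local Open Scope ring_scope.

(** Write s for the square root of 2, alpha = [0; x_1, x_2, ...] and
beta = [0; y_1, y_2, ...], and let P_n / Q_n and P'_n / Q'_n be their
convergents.  Suppose c1 alpha + c2 beta + c3 = 0 with coefficients in Q(s);
clearing denominators, they may be taken in Z[s].

Replacing alpha and beta by their N-th convergents in this relation leaves the
real number g = c1 P_N / Q_N + c2 P'_N / Q'_N + c3.  The terms x_i and y_i are s
times a rational number of denominator i, so theta = N!^2 Q_N Q'_N g lies in
Z[s].  It is small: the errors of the convergents are at most
1/(Q_N Q_(N+1)) and 1/(Q'_N Q'_(N+1)), so |theta| is at most a constant times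
N!^2 2^N / a_(N+1).  Its conjugate is not too large: conjugation changes the
sign of all x_i and y_i, hence changes P_N, Q_N, P'_N, Q'_N at most by a sign,
and so the conjugate of theta is at most a constant times N!^2 Q_N Q'_N.  The
product of the two bounds is at most M^(2^N) (a_1 ... a_N)^2 / a_(N+1) for some
constant M (clearing_cost_le).  When a_(N+1) exceeds M^(2^N) (a_1 ... a_N)^2, the norm of
theta is an integer of absolute value less than 1, so theta = 0 and g = 0
(combination_vanishes).  Such N exist beyond any bound (growth_gap): otherwise
U_N = M^(2^N) a_1 ... a_N would eventually satisfy U_(N+1) <= U_N^3, and a_n
would be at most c^(3^n) for a constant c.

For each of these N, subtracting g = 0 from the relation leaves
c1 (alpha - P_N / Q_N) = - c2 (beta - P'_N / Q'_N).  The errors of convergents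
are also at least half of their upper bounds, so if c2 is nonzero then
Q_N Q_(N+1) / (Q'_N Q'_(N+1)) stays bounded along these N.  But Q_N / Q'_N tends
to infinity (den_ratio_unbounded): it is at least a constant times the product of the
x_i / (y_i + 1), which are close to 1 + i / p_i and from some index on at least
(1 - 1/p_i)^-1, so the divergence of Euler's product, obtained by sieving the
harmonic sum (euler_product_cvg0), suffices.  Hence c2 = 0,
then c1 = 0, because an error of a convergent is not zero, and c3 = 0. *)

(** * Continuants and convergents *)

(** The value at n of the solution of z_(k+1) = x_(k+1) z_k + z_(k-1) with
z_(-1) = z0 and z_0 = z1.  The recursion consumes the terms from the front, as
that of [fin_cfrac] does; the recurrence itself is [continuantSS]. *)
Fixpoint continuant (R : realType) (z0 z1 : R) (x : nat -> R) (n : nat) : R :=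
  if n is m.+1 then continuant z1 (x 1%N * z1 + z0) (fun k => x k.+1) m else z1.

Definition cf_num (R : realType) (x : nat -> R) := continuant 1 0 x.
Definition cf_den (R : realType) (x : nat -> R) := continuant 0 1 x.

Section Continuants.
Context {R : realType}.
Implicit Types x y : nat -> R.

Lemma continuantSS (z0 z1 : R) x n :
  continuant z0 z1 x n.+2 =
    x n.+2 * continuant z0 z1 x n.+1 + continuant z0 z1 x n.
Proof. by elim: n x z0 z1 => [//|n IHn] x z0 z1; apply: IHn. Qed.

Lemma continuant_gt0 (z0 z1 : R) x n : (forall k, 0 < x k.+1) ->
  0 <= z0 -> 0 < z1 -> 0 < continuant z0 z1 x n.
Proof.
elim: n x z0 z1 => [//|n IHn] x z0 z1 x_gt0 z0_ge0 z1_gt0 /=.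
apply: IHn => //; first exact: ltW.
by apply: ltr_wpDr => //; apply: mulr_gt0.
Qed.

(** Carrying an affine function A f + B of the finite continued fraction is what
makes the induction on n go through: peeling off x0 turns it into
(A' g + A) / g, where g starts one term later and A' = A x0 + B, and both
numerator and denominator are again affine in g. *)
Lemma fin_cfrac_continuant (A B x0 : R) x n : (forall k, 0 < x k.+1) ->
  A * fin_cfrac x0 x n + B = continuant A (A * x0 + B) x n / cf_den x n.
Proof.
rewrite /cf_den; elim: n x x0 A B => [|n IHn] x x0 A B x_gt0.
  by rewrite /= divr1.
pose x' k := x k.+1; have x'_gt0 k : 0 < x' k.+1 by apply: x_gt0.
have den_neq0 : continuant 0 1 x' n != 0.
  by rewrite gt_eqF // continuant_gt0.
have cont_neq0 : continuant 1 (x 1%N) x' n != 0.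
  by rewrite gt_eqF // continuant_gt0 // ler01.
have := IHn x' (x 1%N) 1 0 x'_gt0; rewrite mul1r !addr0 mul1r => gE.
have := IHn x' (x 1%N) (A * x0 + B) A x'_gt0.
rewrite /= -/x' mulr1 addr0 [x 1%N * (A * x0 + B)]mulrC gE => {}IHn.
have -> : continuant (A * x0 + B) ((A * x0 + B) * x 1%N + A) x' n =
  (A * x0 + B) * continuant 1 (x 1%N) x' n + A * continuant 0 1 x' n.
  by apply: (mulIf (invr_neq0 den_neq0)); rewrite -IHn; field.
by field; rewrite cont_neq0 den_neq0.
Qed.

Lemma fin_cfrac_convergent x n : (forall k, 0 < x k.+1) ->
  fin_cfrac 0 x n = cf_num x n / cf_den x n.
Proof.
move=> x_gt0; have := fin_cfrac_continuant 1 0 0 n x_gt0.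
by rewrite !mul1r !addr0.
Qed.

Lemma cf_denS x n : cf_den x n.+2 = x n.+2 * cf_den x n.+1 + cf_den x n.
Proof. exact: continuantSS. Qed.

Lemma cf_numS x n : cf_num x n.+2 = x n.+2 * cf_num x n.+1 + cf_num x n.
Proof. exact: continuantSS. Qed.

Lemma cf_den0 x : cf_den x 0 = 1. Proof. by []. Qed.
Lemma cf_den1 x : cf_den x 1 = x 1%N.
Proof. by rewrite /cf_den /= mulr1 addr0. Qed.
Lemma cf_num0 x : cf_num x 0 = 0. Proof. by []. Qed.
Lemma cf_num1 x : cf_num x 1 = 1.
Proof. by rewrite /cf_num /= mulr0 add0r. Qed.

Lemma cf_den_gt0 x n : (forall k, 0 < x k.+1) -> 0 < cf_den x n.
Proof. by move=> x_gt0; apply: continuant_gt0. Qed.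

Lemma cf_det x n :
  cf_num x n.+1 * cf_den x n - cf_num x n * cf_den x n.+1 = (-1) ^+ n.
Proof.
elim: n => [|n IHn]; first by rewrite cf_num1 cf_num0 cf_den0; ring.
by rewrite cf_denS cf_numS exprS -IHn; ring.
Qed.

Lemma cf_den_leS x n : (forall k, 1 <= x k.+1) ->
  x n.+1 * cf_den x n <= cf_den x n.+1 <= (x n.+1 + 1) * cf_den x n.
Proof.
move=> x_ge1; have x_gt0 k : 0 < x k.+1 by apply: lt_le_trans (x_ge1 k).
case: n => [|n]; first by rewrite cf_den1 cf_den0; lra.
have den_gt0 := cf_den_gt0 _ x_gt0.
have den_le : cf_den x n <= cf_den x n.+1.
  case: n => [|n]; first by rewrite cf_den1 cf_den0.
  rewrite cf_denS; have := ler_peMl (ltW (den_gt0 n.+1)) (x_ge1 n.+1).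
  have := den_gt0 n; lra.
by rewrite cf_denS mulrDl mul1r lerD2l den_le andbT lerDl ltW.
Qed.

Lemma cf_den_le x n : (forall k, 1 <= x k.+1) -> cf_den x n <= cf_den x n.+1.
Proof.
move=> x_ge1; have x_gt0 k : 0 < x k.+1 by apply: lt_le_trans (x_ge1 k).
have /andP[+ _] := cf_den_leS n x_ge1; apply: le_trans.
by rewrite ler_peMl // ltW // cf_den_gt0.
Qed.

(** The distance between the convergents of index n and n + 1. *)
Definition cf_gap x n : R := (cf_den x n * cf_den x n.+1)^-1.

Lemma cf_gap_gt0 x n : (forall k, 0 < x k.+1) -> 0 < cf_gap x n.
Proof. by move=> x_gt0; rewrite invr_gt0 mulr_gt0 // cf_den_gt0. Qed.

(** Terms at least 1 give Q_(n+2) >= Q_(n+1) + Q_n >= 2 Q_n. *)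
Lemma cf_gap_half x n : (forall k, 1 <= x k.+1) ->
  cf_gap x n.+1 <= cf_gap x n / 2.
Proof.
move=> x_ge1; have x_gt0 k : 0 < x k.+1 by apply: lt_le_trans (x_ge1 k).
have den_gt0 := cf_den_gt0 _ x_gt0.
rewrite /cf_gap -invfM lef_pV2 ?posrE ?mulr_gt0 //.
have : 2 * cf_den x n <= cf_den x n.+2.
  rewrite cf_denS; have := ler_peMl (ltW (den_gt0 n.+1)) (x_ge1 n.+1).
  have := cf_den_le n x_ge1; lra.
move/(ler_wpM2l (ltW (den_gt0 n.+1))); lra.
Qed.

Lemma fin_cfrac_step x n : (forall k, 0 < x k.+1) ->
  (-1) ^+ n * (fin_cfrac 0 x n.+1 - fin_cfrac 0 x n) = cf_gap x n.
Proof.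
move=> x_gt0; rewrite !fin_cfrac_convergent // /cf_gap.
have n_neq0 : cf_den x n != 0 by rewrite gt_eqF // cf_den_gt0.
have m_neq0 : cf_den x n.+1 != 0 by rewrite gt_eqF // cf_den_gt0.
have -> : cf_num x n.+1 / cf_den x n.+1 - cf_num x n / cf_den x n =
   (-1) ^+ n / (cf_den x n * cf_den x n.+1).
  by rewrite -(cf_det x); field; rewrite n_neq0 m_neq0.
by rewrite mulrA -expr2 sqrr_sign mul1r.
Qed.

(** The steps between convergents alternate in sign and decrease in size, so
all later convergents lie between two consecutive ones. *)
Lemma fin_cfrac_alternating x n k : (forall k, 1 <= x k.+1) ->
  0 <= (-1) ^+ n * (fin_cfrac 0 x (n + k) - fin_cfrac 0 x n) <= cf_gap x n.
Proof.
move=> x_ge1; have x_gt0 j : 0 < x j.+1 by apply: lt_le_trans (x_ge1 j).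
elim: k n => [|k IHk] n.
  by rewrite addn0 subrr mulr0 lexx ltW // cf_gap_gt0.
have := IHk n.+1; rewrite addSnnS exprS.
have := fin_cfrac_step n x_gt0; have := cf_gap_half n x_ge1.
have := cf_gap_gt0 n x_gt0; lra.
Qed.

Lemma cf_gap_geometric x n : (forall k, 1 <= x k.+1) ->
  cf_gap x n <= 2^-1 ^+ n.
Proof.
move=> x_ge1; elim: n => [|n IHn].
  by rewrite /cf_gap expr0 cf_den0 cf_den1 mul1r invf_le1 ?(lt_le_trans ltr01).
by rewrite (le_trans (cf_gap_half n x_ge1)) // exprSr ler_pM2r // invr_gt0.
Qed.

Lemma cf_num_le_den x n : (forall k, 1 <= x k.+1) ->
  cf_num x n <= cf_den x n.
Proof.
move=> x_ge1; have x_gt0 k : 0 < x k.+1 by apply: lt_le_trans (x_ge1 k).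
suff [] : cf_num x n <= cf_den x n /\ cf_num x n.+1 <= cf_den x n.+1 by [].
elim: n => [|n [IHn IHSn]].
  by rewrite cf_num0 cf_num1 cf_den0 cf_den1 ler01.
by split=> //; rewrite cf_numS cf_denS lerD // ler_pM2l.
Qed.

(** With c = 1 this is the monotonicity of denominators in the terms. *)
Lemma cf_den_le_exp (c : R) x y n : 1 <= c ->
  (forall k, 0 < x k.+1) ->
  (forall k, x k.+1 <= c * y k.+1) -> cf_den x n <= c ^+ n * cf_den y n.
Proof.
move=> c_ge1 x_gt0 le_xy.
have c_gt0 : 0 < c by apply: lt_le_trans c_ge1.
have y_gt0 k : 0 < y k.+1.
  by have := lt_le_trans (x_gt0 k) (le_xy k); rewrite pmulr_rgt0.
suff [] : cf_den x n <= c ^+ n * cf_den y n /\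
  cf_den x n.+1 <= c ^+ n.+1 * cf_den y n.+1 by [].
elim: n => [|n [IHn IHSn]].
  by rewrite !cf_den0 !cf_den1 expr0 expr1 mulr1 lexx.
split=> //; rewrite !cf_denS mulrDr lerD //.
  rewrite exprS mulrCA !mulrA [_ * c]mulrC -mulrA.
  by apply: ler_pM => //; rewrite ltW // cf_den_gt0.
apply: le_trans IHn _; rewrite ler_pM2r ?cf_den_gt0 //.
by apply: ler_weXn2l => //; apply: leqW; apply: leqnSn.
Qed.

End Continuants.

(** * Convergence and two-sided error bounds *)

Section Limit.
Context {R : realType}.
Implicit Types x y : nat -> R.

Lemma cvg_fin_cfrac x : (forall k, 1 <= x k.+1) ->
  cvgn (fin_cfrac 0 x).
Proof.
move=> x_ge1; have x_gt0 k : 0 < x k.+1 by apply: lt_le_trans (x_ge1 k).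
have fE : fin_cfrac 0 x = series (fun n => (-1) ^+ n * cf_gap x n).
  apply/funext; elim=> [|n IHn]; first by rewrite /series /= big_geq.
  rewrite seriesSr -IHn -fin_cfrac_step // mulrA -expr2 sqrr_sign mul1r.
  by rewrite addrC subrK.
rewrite fE; apply: normed_cvg.
apply: (@series_le_cvg _ _ (fun n => 2^-1 ^+ n)).
- by move=> n /=.
- by move=> n; apply: exprn_ge0; rewrite invr_ge0.
- move=> n; rewrite /= normrM normrX normrN1 expr1n mul1r.
  rewrite ger0_norm; first exact: cf_gap_geometric.
  by apply/ltW/cf_gap_gt0.
have := @is_cvg_geometric_series R 1 2^-1.
rewrite ger0_norm ?invr_ge0 // invf_lt1 // ltr1n => /(_ isT).
by congr (cvgn (series _)); apply/funext => n; rewrite /= mul1r.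
Qed.

(** The lower bound comes from halving: past the first step, of size
[cf_gap x n], the convergents come back by at most [cf_gap x n.+1]. *)
Lemma cfrac_error x n : (forall k, 1 <= x k.+1) ->
  cf_gap x n / 2 <= `|cfrac 0 x - fin_cfrac 0 x n| <= cf_gap x n.
Proof.
move=> x_ge1; have x_gt0 k : 0 < x k.+1 by apply: lt_le_trans (x_ge1 k).
have cvg_e : (-1) ^+ n * (fin_cfrac 0 x m - fin_cfrac 0 x n) @[m --> \oo] -->
    (-1) ^+ n * (cfrac 0 x - fin_cfrac 0 x n).
  by apply: cvgMr; apply: cvgB; [exact: cvg_fin_cfrac|exact: cvg_cst].
have near_e : \forall m \near \oo, cf_gap x n / 2 <=
    (-1) ^+ n * (fin_cfrac 0 x m - fin_cfrac 0 x n) <= cf_gap x n.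
  near=> m.
  have ltnm : (n < m)%N by near: m; exact: nbhs_infty_gt.
  have := fin_cfrac_alternating n (m - n) x_ge1.
  have := fin_cfrac_alternating n.+1 (m - n.+1) x_ge1.
  rewrite !subnKC // 1?ltnW // exprS.
  have := fin_cfrac_step n x_gt0; have := cf_gap_half n x_ge1; lra.
have -> : `|cfrac 0 x - fin_cfrac 0 x n| =
    `|(-1) ^+ n * (cfrac 0 x - fin_cfrac 0 x n)|.
  by rewrite normrM normrX normrN1 expr1n mul1r.
have lo : cf_gap x n / 2 <= (-1) ^+ n * (cfrac 0 x - fin_cfrac 0 x n).
  rewrite -(cvg_lim (@Rhausdorff R) cvg_e); apply: limr_ge.
    by apply/cvg_ex; eexists; exact: cvg_e.
  by apply: filterS near_e => m /andP[].
have hi : (-1) ^+ n * (cfrac 0 x - fin_cfrac 0 x n) <= cf_gap x n.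
  rewrite -(cvg_lim (@Rhausdorff R) cvg_e); apply: limr_le.
    by apply/cvg_ex; eexists; exact: cvg_e.
  by apply: filterS near_e => m /andP[].
rewrite ger0_norm ?lo ?hi //; apply: le_trans lo.
by rewrite divr_ge0 // ltW // cf_gap_gt0.
Unshelve. all: by end_near. Qed.

End Limit.

(** * Arithmetic of Z[sqrt 2] and Q(sqrt 2) *)

Section Sqrt2.
Context {R : realType}.
Local Notation s := (Num.sqrt 2 : R).

Lemma sqr_sqrt2 : s * s = 2.
Proof. by rewrite -expr2 sqr_sqrtr. Qed.

Lemma sqrt2_bounds : 1 <= s <= 2.
Proof.
have s_ge0 := sqrtr_ge0 (2 : R); have := sqr_sqrt2.
by move=> ss; apply/andP; split; nra.
Qed.

(** The 2-adic valuation of the left side is even, that of the right side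
odd. *)
Lemma int_norm_eq0 (u v : int) : u ^+ 2 = 2 * v ^+ 2 -> u = 0 /\ v = 0.
Proof.
move=> uv; suff v0 : v = 0.
  by split=> //; apply/eqP; rewrite -sqrf_eq0 uv v0.
apply/eqP; apply: contraT => v_neq0.
have u_neq0 : u != 0.
  by rewrite -sqrf_eq0 uv mulf_neq0 // expf_neq0.
have /(congr1 (fun z : int => odd (logn 2 `|z|))) := uv.
rewrite abszM !abszX lognM ?expn_gt0 ?absz_gt0 ?v_neq0 //.
by rewrite !lognX !mul2n oddD !odd_double.
Qed.

(** The product of the two factors is an integer, the norm; it vanishes only
at 0. *)
Lemma zsqrt2_small_eq0 (u v : int) :
  `|u%:~R + v%:~R * s| * `|u%:~R - v%:~R * s| < 1 ->
  u%:~R + v%:~R * s = 0.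
Proof.
rewrite -normrM.
have -> : (u%:~R + v%:~R * s) * (u%:~R - v%:~R * s) =
   (u ^+ 2 - 2 * v ^+ 2)%:~R.
  rewrite intrB intrM !rmorphXn /=; ring: sqr_sqrt2.
rewrite -intr_norm -[1]/(1%:~R) ltr_int => lt1.
have /int_norm_eq0[-> ->] : u ^+ 2 = 2 * v ^+ 2 by lia.
by rewrite mul0r addr0.
Qed.

(** The reals of this form are a subfield containing the square root of 2; the
inverse of u + v s is obtained by multiplying with its conjugate. *)
Lemma rat_adjoin_sqrt2 (c : R) : rat_adjoin s c ->
  exists d u v : int, d != 0 /\ d%:~R * c = u%:~R + v%:~R * s.
Proof.
pose K : {pred R} := [pred y | `[< exists d u v : int,
  d != 0 /\ d%:~R * y = u%:~R + v%:~R * s >]].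
move=> /(_ K) Kc; apply/asboolP; apply: Kc; last first.
  apply/asboolP; exists 1, 0, 1; split=> //; ring.
split.
- by apply/asboolP; exists 1, 1, 0; split=> //; ring.
- move=> y y' /asboolP[d [u [v [d0 yE]]]] /asboolP[d' [u' [v' [d'0 y'E]]]].
  apply/asboolP; exists (d * d'), (d' * u - d * u'), (d' * v - d * v').
  split; first exact: mulf_neq0.
  rewrite !intrB !intrM.
  transitivity (d'%:~R * (d%:~R * y) - d%:~R * (d'%:~R * y')); first by ring.
  by rewrite yE y'E; ring.
- move=> y y' /asboolP[d [u [v [d0 yE]]]] /asboolP[d' [u' [v' [d'0 y'E]]]].
  apply/asboolP; have [->|y'0] := eqVneq y' 0.
    by exists 1, 0, 0; split=> //; rewrite invr0; ring.
  pose n := u' ^+ 2 - 2 * v' ^+ 2.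
  have d'R0 : d'%:~R != 0 :> R by rewrite intr_eq0.
  have n0 : n != 0.
    apply/eqP => n0; have /int_norm_eq0[u'0 v'0] : u' ^+ 2 = 2 * v' ^+ 2.
      by move: n0; rewrite /n; lia.
    move: y'E; rewrite u'0 v'0 mul0r addr0 => /eqP.
    by rewrite mulf_eq0 (negPf d'R0) (negPf y'0).
  exists (d * n), (d' * (u * u' - 2 * (v * v'))), (d' * (v * u' - u * v')).
  split; first exact: mulf_neq0.
  apply: (mulIf y'0); rewrite intrM -[LHS]mulrA divfK //.
  apply: (mulfI d'R0).
  have nE : n%:~R = (u'%:~R - v'%:~R * s) * (d'%:~R * y') :> R.
    rewrite y'E /n intrB intrM !rmorphXn /=; ring: sqr_sqrt2.
  rewrite nE !intrM !intrB !intrM.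
  transitivity (d'%:~R * ((u'%:~R - v'%:~R * s) * (d'%:~R * y') * (d%:~R * y))).
    by ring.
  by rewrite yE; ring: sqr_sqrt2.
Qed.

Lemma rationals_sub_adjoin (x : R) : @rationals R `<=` rat_adjoin x.
Proof.
move=> _ [q _ <-] K [K1 KB KV] _.
have K0 : 0 \in K by rewrite -(subrr 1) KB.
have KN y : y \in K -> - y \in K by move=> Ky; rewrite -sub0r KB.
have Kn n : n%:R \in K.
  elim: n => [//|n IHn].
  have -> : n.+1%:R = n%:R - (- 1) :> R by rewrite opprK natr1.
  by rewrite KB // KN.
have Kz (z : int) : z%:~R \in K.
  by case: z => n; rewrite ?NegzE ?mulrNz ?KN //; exact: Kn.
by rewrite /ratr KV.
Qed.

(** Each term contributes one factor sqrt 2, which flips the parity of the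
power of sqrt 2 carried by z; two such factors make the integer 2.  The parity
is what later controls conjugates. *)
Lemma sqrt2_integrality (A : nat -> nat) (b : bool) (z : nat -> R)
    (m0 m1 : nat) :
  z 0%N = m0%:R * s ^+ b -> z 1%N = m1%:R * s ^+ (~~ b) ->
  (forall n, z n.+2 = (A n.+2)%:R / n.+2%:R * s * z n.+1 + z n) ->
  forall n, exists m : nat, n`!%:R * z n = m%:R * s ^+ (b (+) odd n).
Proof.
move=> z0 z1 zSS n.
suff [] : (exists m : nat, n`!%:R * z n = m%:R * s ^+ (b (+) odd n)) /\
  (exists m : nat, n.+1`!%:R * z n.+1 = m%:R * s ^+ (b (+) odd n.+1)) by [].
elim: n => [|n [[k kE] [l lE]]].
  by split; [exists m0|exists m1]; rewrite mul1r ?addbF ?addbT.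
split; first by exists l.
exists ((A n.+2) * l * (if b (+) odd n.+1 then 2 else 1) + n.+2 * n.+1 * k)%N.
have -> : n.+2`!%:R * z n.+2 = (A n.+2)%:R * s * (n.+1`!%:R * z n.+1) +
    n.+2%:R * n.+1%:R * (n`!%:R * z n).
  by rewrite zSS !factS !natrM; field; rewrite -natrD pnatr_eq0.
rewrite kE lE /= negbK addbN.
by case: (b (+) odd n) => /=; ring: sqr_sqrt2.
Qed.

Lemma convergent_integrality (A : nat -> nat) (x : nat -> R) n :
  (forall k, x k.+1 = (A k.+1)%:R / k.+1%:R * s) ->
  exists m k : nat, n`!%:R * cf_den x n = m%:R * s ^+ odd n /\
    n`!%:R * cf_num x n = k%:R * s ^+ (~~ odd n).
Proof.
move=> xE.
have [|||m mE] := @sqrt2_integrality A false (cf_den x) 1 (A 1%N) _ _ _ n.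
- by rewrite cf_den0 mulr1.
- by rewrite cf_den1 xE divr1.
- by move=> k; rewrite -xE cf_denS.
have [|||k kE] := @sqrt2_integrality A true (cf_num x) 0 1 _ _ _ n.
- by rewrite cf_num0 mul0r.
- by rewrite cf_num1 mulr1.
- by move=> k; rewrite -xE cf_numS.
by exists m, k.
Qed.

End Sqrt2.

(** * The growth of the partial quotients *)

(** A sequence growing faster than every c^(3^n) exceeds, infinitely often, the
square of the product of its earlier terms, even with a factor M^(2^N) to spare:
the exponent 3 is 1 + 2, and 2^N is negligible against 3^N. *)
Lemma growth_gap (R : realType) (a : nat -> nat) :
  (forall n, (1 <= n)%N -> (0 < a n)%N) ->
  ((a n)%:R : R) `^ (3 ^+ n)^-1 @[n --> \oo] --> +oo ->
  forall M N0 : nat, exists2 N, (N0 <= N)%N &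
    (M ^ (2 ^ N) * (\prod_(1 <= i < N.+1) a i) ^ 2 < a N.+1)%N.
Proof.
move=> a_gt0 a_growth M N0; apply: contrapT => noN.
have aS_le N : (N0 <= N)%N ->
    (a N.+1 <= M.+1 ^ (2 ^ N) * (\prod_(1 <= i < N.+1) a i) ^ 2)%N.
  move=> leN; rewrite leqNgt; apply/negP => lt_a; apply: noN; exists N => //.
  apply: leq_ltn_trans lt_a; rewrite leq_mul2r leq_exp2r ?leqnSn ?orbT//.
  by rewrite expn_gt0.
pose T N := (\prod_(1 <= i < N.+1) a i)%N.
have T_gt0 N : (0 < T N)%N.
  rewrite /T big_seq_cond prodn_cond_gt0 // => i.
  by rewrite mem_index_iota andbT => /andP[/a_gt0].
(* The factor M.+1 ^ (2 ^ N) is chosen so that cubing U N absorbs both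
   M.+1 ^ (2 ^ N) and the passage to M.+1 ^ (2 ^ N.+1). *)
pose U N := (M.+1 ^ (2 ^ N) * T N)%N.
have US N : (N0 <= N)%N -> (U N.+1 <= U N ^ 3)%N.
  move=> leN; rewrite /U {1}/T big_nat_recr //= -/(T N) !expnMn.
  apply: (@leq_trans (M.+1 ^ (2 ^ N.+1) * (T N * (M.+1 ^ (2 ^ N) * T N ^ 2)))).
    by rewrite !leq_mul2l aS_le // !orbT.
  apply: eq_leq; rewrite expnSr expnM; move: (M.+1 ^ (2 ^ N))%N (T N) => u v.
  by ring.
have U_le k : (U (N0 + k) <= U N0 ^ (3 ^ (N0 + k)))%N.
  elim: k => [|k IHk].
    rewrite addn0 -{1}[U N0]expn1 leq_pexp2l ?expn_gt0 //.
    by rewrite muln_gt0 expn_gt0 T_gt0.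
  rewrite addnS (leq_trans (US _ (leq_addr _ _))) // [(3 ^ _.+1)%N]expnSr expnM.
  by rewrite leq_exp2r.
have /cvgryPge /(_ ((U N0).+1%:R)) := a_growth.
case=> n1 _ /(_ (N0 + n1).+1) /= big_a.
have := big_a (leqW (leq_addl _ _)).
set n := (N0 + n1).+1 => {}big_a.
have a_ge : (U N0).+1%:R ^+ (3 ^ n) <= (a n)%:R :> R.
  have : (U N0).+1%:R ^+ (3 ^ n) <= ((a n)%:R `^ (3 ^+ n)^-1) ^+ (3 ^ n) :> R.
    by apply: lerXn2r => //; rewrite nnegrE ?powR_ge0.
  rewrite -[X in _ <= X -> _]powR_mulrn ?powR_ge0 // -powRrM natrX
    mulVf ?powRr1 ?ler0n ?expf_neq0 ?pnatr_eq0 //.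
move: a_ge; rewrite -natrX ler_nat leqNgt => /negP; apply.
apply: (@leq_ltn_trans (U n)).
  rewrite /U /T big_nat_recr //= mulnA leq_pmull // muln_gt0 expn_gt0.
  exact: T_gt0.
rewrite /n -addnS (leq_ltn_trans (U_le _)) // ltn_exp2r //.
by rewrite expn_gt0.
Qed.

(** * Primes *)

Lemma sum_multiples (R : zmodType) (G : nat -> R) d M : (0 < d)%N ->
  \sum_(1 <= m < M.+1 | (d %| m)%N) G m =
  \sum_(1 <= j < (M %/ d).+1) G (d * j)%N.
Proof.
move=> d_gt0; elim: M => [|M IHM]; first by rewrite div0n !big_geq.
rewrite big_mkcond big_nat_recr //= -big_mkcond IHM divnS //.
case: ifP => [dM|_] /=; last by rewrite addr0 add0n.
rewrite add1n [RHS]big_nat_recr //=; congr (_ + G _).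
have := divnK dM; rewrite divnS // dM add1n mulnC; exact: esym.
Qed.

Section Primes.
Variable p : nat -> nat.
Hypothesis p_increasing : forall m n, (1 <= m < n)%N -> (p m < p n)%N.
Hypothesis p_primes : forall q, prime q <-> exists2 n, (1 <= n)%N & p n = q.

Lemma nth_prime_prime n : (1 <= n)%N -> prime (p n).
Proof. by move=> n_gt0; apply/p_primes; exists n. Qed.

Lemma nth_prime_le m n : (1 <= m <= n)%N -> (p m <= p n)%N.
Proof.
move=> /andP[m_gt0]; rewrite leq_eqVlt => /predU1P[->//|ltmn].
by rewrite ltnW // p_increasing // m_gt0.
Qed.

Lemma nth_prime_gt n : (1 <= n)%N -> (n < p n)%N.
Proof.
elim: n => [//|[|n] IHn] _; first exact/prime_gt1/nth_prime_prime.
by apply: leq_ltn_trans (IHn _) _ => //; apply: p_increasing; rewrite /= ltnS.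
Qed.

(** Euclid's argument: a prime factor of the successor of the product of the
first n primes has index greater than n. *)
Lemma nth_prime_euclid n : (p n.+1 <= (\prod_(1 <= i < n.+1) p i).+1)%N.
Proof.
set W := (\prod_(1 <= i < n.+1) p i)%N.
have W_gt0 : (0 < W)%N.
  rewrite /W big_seq_cond prodn_cond_gt0 // => i.
  by rewrite mem_index_iota andbT => /andP[/nth_prime_prime/prime_gt0].
have := pdiv_prime (_ : 1 < W.+1)%N; rewrite ltnS => /(_ W_gt0) q_prime.
apply: leq_trans (pdiv_leq (ltn0Sn W)).
have /p_primes[k k_gt0 pkE] := q_prime.
rewrite -pkE; apply: nth_prime_le => /=; rewrite ltnNge; apply/negP => lekn.
have : (p k %| W)%N.
  rewrite /W (bigD1_seq k) ?iota_uniq //= ?dvdn_mulr //.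
  by rewrite mem_index_iota k_gt0 ltnS.
have := pdiv_dvd W.+1; rewrite -pkE -addn1 => pkW1 /(dvdn_addr 1).
rewrite pkW1 dvdn1 => /esym /eqP pk1.
by have := prime_gt1 q_prime; rewrite -pkE pk1.
Qed.

(** Twice the primorial is at most squared from n to n + 1.  A bound of the
form c^(2^n) is all that is needed, as it is negligible against powers 3^n. *)
Lemma primorial_le n : (\prod_(1 <= i < n.+1) p i <= 2 ^ (2 ^ n))%N.
Proof.
suff: (2 * \prod_(1 <= i < n.+1) p i <= 2 ^ (2 ^ n))%N.
  by apply: leq_trans; rewrite leq_pmull.
elim: n => [|n IHn]; first by rewrite big_geq.
rewrite big_nat_recr //= expnSr expnM.
have := nth_prime_euclid n; move: IHn.
set W := (\prod_(1 <= i < n.+1) p i)%N; move: (2 ^ 2 ^ n)%N => T.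
have : (0 < W)%N.
  rewrite /W big_seq_cond prodn_cond_gt0 // => i.
  by rewrite mem_index_iota andbT => /andP[/nth_prime_prime/prime_gt0].
move: W (p n.+1) => W q; nia.
Qed.

Lemma factorial_le_primorial n : (n`! <= \prod_(1 <= i < n.+1) p i)%N.
Proof.
elim: n => [|n IHn]; first by rewrite big_geq.
by rewrite factS big_nat_recr //= mulnC leq_mul // ltnW // nth_prime_gt.
Qed.

Section Sieve.
Variable R : realType.

Definition rough k m := all (fun i => ~~ (p i %| m)%N) (iota 1 k).

Lemma roughS k m : rough k.+1 m = rough k m && ~~ (p k.+1 %| m)%N.
Proof.
have := iotaD 1 k 1; rewrite addn1 /rough => ->.
by rewrite all_cat /= andbT add1n.
Qed.

Lemma rough_mul k d m : rough k (d * m)%N -> rough k m.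
Proof.
by apply: sub_all => i; apply: contra => /dvdn_mull; apply.
Qed.

Definition rough_sum k M : R := \sum_(1 <= m < M.+1 | rough k m) m%:R^-1.

(** The integers removed in this sieving step are multiples d m of d = p_(k+1)
with m itself rough, so their reciprocals add up to at most 1/d times the
whole sum. *)
Lemma rough_sumS k M :
  (1 - (p k.+1)%:R^-1) * rough_sum k M <= rough_sum k.+1 M.
Proof.
set d := p k.+1; have d_gt0 : (0 < d)%N by apply/prime_gt0/nth_prime_prime.
pose G m : R := if rough k m then m%:R^-1 else 0.
have G_ge0 m : 0 <= G m by rewrite /G; case: ifP; rewrite ?invr_ge0.
have sumG : rough_sum k M = \sum_(1 <= m < M.+1) G m by exact: big_mkcond.
rewrite mulrBl mul1r lerBlDr {1}sumG (bigID (fun m => (d %| m)%N)) /= addrC.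
apply: lerD.
  rewrite /rough_sum /G -big_mkcondr le_eqVlt; apply/orP; left; apply/eqP.
  by apply: eq_bigl => m; rewrite roughS andbC.
rewrite sum_multiples // sumG mulr_sumr.
rewrite [leRHS](big_cat_nat (n := (M %/ d).+1)) //= ?ltnS ?leq_div //.
apply: ler_wpDr.
  by apply: sumr_ge0 => i _; rewrite mulr_ge0 // invr_ge0.
apply: ler_sum => m _; rewrite /G.
case: ifP => [/rough_mul ->|_]; first by rewrite natrM invfM.
by rewrite mulr_ge0 ?invr_ge0 //; case: ifP; rewrite ?invr_ge0.
Qed.

(** Sieve [1, N] by the first N primes: only 1 survives, since p_i > i
puts all primes up to N among them. *)
Lemma euler_product_le N :
  (\prod_(1 <= i < N.+1) (1 - (p i)%:R^-1)) *
    (\sum_(1 <= m < N.+1) m%:R^-1) <= 1 :> R.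
Proof.
have le_rough k : (\prod_(1 <= i < k.+1) (1 - (p i)%:R^-1)) *
    (\sum_(1 <= m < N.+1) m%:R^-1) <= rough_sum k N.
  elim: k => [|k IHk]; first by rewrite big_geq // mul1r.
  apply: le_trans (rough_sumS k N); rewrite big_nat_recr //= mulrAC mulrC.
  apply: ler_wpM2l => //; rewrite subr_ge0 invf_le1 ?ltr0n ?ler1n.
    exact/prime_gt0/nth_prime_prime.
  exact/prime_gt0/nth_prime_prime.
apply: le_trans (le_rough N) _.
case: N {le_rough} => [|N]; first by rewrite /rough_sum big_geq.
rewrite /rough_sum big_ltn_cond // big_seq_cond big_pred0.
  by case: ifP; rewrite ?addr0 ?invr1 ?ler01.
move=> m; rewrite mem_index_iota; apply/negP => /andP[/andP[m_gt1 m_le]].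
have /p_primes[i i_gt0 pE] := pdiv_prime m_gt1.
move=> /allP /(_ i); rewrite mem_iota i_gt0 /= add1n pE pdiv_dvd => /(_ _)/negP.
apply=> //; apply: leq_ltn_trans m_le.
apply: leq_trans (ltnW (nth_prime_gt i_gt0)) _; rewrite pE; apply: pdiv_leq.
exact: ltnW.
Qed.

Lemma euler_product_cvg0 (e : R) : 0 < e ->
  exists N0, forall N, (N0 <= N)%N ->
    \prod_(1 <= i < N.+1) (1 - (p i)%:R^-1) <= e.
Proof.
move=> e_gt0.
have hE N : \sum_(1 <= m < N.+1) m%:R^-1 = series (@harmonic R) N.
  by rewrite /series /= big_add1.
have /nondecreasing_dvgn_lt/(_ (@dvg_harmonic R)) :
    nondecreasing_seq (series (@harmonic R)).
  by apply: nondecreasing_series => n _ _; apply: harmonic_ge0.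
move=> /cvgryPge /(_ e^-1)[N0 _ H_ge]; exists N0 => N /H_ge /= {}H_ge.
have := euler_product_le N; rewrite hE => le1.
have e'_gt0 : 0 < e^-1 by rewrite invr_gt0.
have H_gt0 := lt_le_trans e'_gt0 H_ge.
rewrite -ler_pdivlMr // mul1r in le1; apply: le_trans le1 _.
by rewrite -[leRHS]invrK lef_pV2.
Qed.

End Sieve.
End Primes.

(** * The two continued fractions *)

Section Main.
Variables (R : realType) (a p : nat -> nat).
Hypothesis a_gt0 : forall n, (1 <= n)%N -> (0 < a n)%N.
Hypothesis a_growth : ((a n)%:R : R) `^ (3 ^+ n)^-1 @[n --> \oo] --> +oo.
Hypothesis p_increasing : forall m n, (1 <= m < n)%N -> (p m < p n)%N.
Hypothesis p_primes : forall q, prime q <-> exists2 n, (1 <= n)%N & p n = q.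

Local Notation s := (Num.sqrt 2 : R).
Let x n : R := (a n)%:R * (1 + (p n)%:R / n%:R) * s.
Let y n : R := (a n)%:R * ((p n)%:R / n%:R) * s.

Let aR_ge1 n : 1 <= (a n.+1)%:R :> R.
Proof. by rewrite ler1n a_gt0. Qed.

Let pn_bounds n : 1 <= ((p n.+1)%:R / n.+1%:R : R) <= (p n.+1)%:R.
Proof.
rewrite ler_pdivlMr // mul1r ler_nat.
rewrite (ltnW (nth_prime_gt p_increasing p_primes _)) //=.
by rewrite ler_pdivrMr // ler_peMr // ler1n.
Qed.

Lemma x_addE n : x n = y n + (a n)%:R * s.
Proof. by rewrite /x /y; ring. Qed.

Lemma y_ge1 n : 1 <= y n.+1.
Proof.
have /andP[s1 _] := @sqrt2_bounds R; have /andP[p1 _] := pn_bounds n.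
exact: mulr_ege1 (mulr_ege1 (aR_ge1 n) p1) s1.
Qed.

Lemma x_ge1 n : 1 <= x n.+1.
Proof.
have /andP[s1 _] := @sqrt2_bounds R; rewrite x_addE.
have := y_ge1 n; have := mulr_ege1 (aR_ge1 n) s1; lra.
Qed.

Let x_gt0 n : 0 < x n.+1. Proof. exact: lt_le_trans (x_ge1 n). Qed.
Let y_gt0 n : 0 < y n.+1. Proof. exact: lt_le_trans (y_ge1 n). Qed.

Lemma y_le_x n : y n.+1 <= x n.+1.
Proof.
by rewrite x_addE lerDl mulr_ge0.
Qed.

Lemma x_le_2y n : x n.+1 <= 2 * y n.+1.
Proof.
have /andP[s1 _] := @sqrt2_bounds R; have /andP[p1 _] := pn_bounds n.
have : (a n.+1)%:R * s <= y n.+1 by rewrite /y mulrAC ler_peMr // mulr_ge0.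
rewrite x_addE; lra.
Qed.

Let Q := cf_den x. Let P := cf_num x.
Let Q' := cf_den y. Let P' := cf_num y.

Lemma den_y_le_den_x n : Q' n <= Q n.
Proof.
have := @cf_den_le_exp R 1 y x n (lexx 1) y_gt0.
by rewrite expr1n mul1r; apply=> k; rewrite mul1r y_le_x.
Qed.

Lemma den_x_le_den_y n : Q n <= 2 ^+ n * Q' n.
Proof. by apply: cf_den_le_exp => //; [lra|exact: x_le_2y]. Qed.

(** Uses x_i + 1 <= a_i (2 p_i) 2 + 1 <= 5 a_i p_i. *)
Lemma den_x_le_prod n :
  Q n <= 5 ^+ n * (\prod_(1 <= i < n.+1) a i)%:R *
    (\prod_(1 <= i < n.+1) p i)%:R.
Proof.
elim: n => [|n IHn]; first by rewrite /Q !big_geq // cf_den0 expr0 !mulr1.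
have /andP[_] := cf_den_leS n x_ge1; move/le_trans; apply.
have -> : 5 ^+ n.+1 * (\prod_(1 <= i < n.+2) a i)%:R *
    (\prod_(1 <= i < n.+2) p i)%:R =
  (5 * ((a n.+1)%:R * (p n.+1)%:R)) * (5 ^+ n *
    (\prod_(1 <= i < n.+1) a i)%:R * (\prod_(1 <= i < n.+1) p i)%:R) :> R.
  by rewrite !(big_nat_recr n.+1) //= !natrM exprS; ring.
apply: ler_pM => //; first by rewrite addr_ge0 // ltW.
  by rewrite ltW // cf_den_gt0.
have /andP[s1 s2] := @sqrt2_bounds R; have /andP[p1 p2] := pn_bounds n.
have a1 := aR_ge1 n; rewrite /x.
move: (a n.+1)%:R (p n.+1)%:R ((p n.+1)%:R / _) a1 p1 p2 => u w v u1 v1 vw.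
have w1 : 1 <= w by lra.
have uw1 : 1 <= u * w by exact: mulr_ege1.
have u0 : 0 <= u by lra.
have : u * (1 + v) * s <= (u * (2 * w)) * 2.
  apply: ler_pM => //; first by rewrite mulr_ge0 //; lra.
  by apply: ler_wpM2l => //; lra.
lra.
Qed.

(** Denominators satisfy Q_(n+1) >= x_(n+1) Q_n and
Q'_(n+1) <= (y_(n+1) + 1) Q'_n.  The constant 1 lost here is affordable once
a_n, n and p_n are at least 3: then y_n + 1 <= (1 - 1/p_n) x_n, so Q_n / Q'_n
grows at least as fast as the inverse of the product of the 1 - 1/p_i. *)
Lemma den_ratio_unbounded (B : R) : 0 < B ->
  exists N0, forall N, (N0 <= N)%N -> B * Q' N <= Q N.
Proof.
move=> B_gt0.
have [n1 n1P] : exists n1, forall n, (n1 <= n)%N -> (3 <= a n)%N.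
  have /cvgryPge /(_ 3)[n1 _ n1P] := a_growth; exists n1 => n /n1P /= a3.
  rewrite -(ler_nat R) leNgt; apply/negP => a_lt3.
  have a_neq0 : (0 < (3 ^+ n)^-1 :> R) by rewrite invr_gt0 exprn_gt0.
  have := lt_le_trans _ a3 => /(_ ((a n)%:R `^ (3 ^+ n)^-1)).
  have [a0|a0] := leqP (a n) 0.
    move: a3; have -> : a n = 0%N by lia.
    by rewrite powR0 ?gt_eqF //; lra.
  have := ler_powR (_ : 1 <= (a n)%:R :> R) (_ : (3 ^+ n)^-1 <= 1 :> R).
  rewrite ler1n a0 invf_le1 ?exprn_gt0 // exprn_ege1 ?ler1n //.
  move=> /(_ isT isT); rewrite powRr1 // => ale; lra.
pose n0 := (n1 + 3)%N.
pose E N : R := \prod_(1 <= i < N.+1) (1 - (p i)%:R^-1).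
have pfac i : (1 <= i)%N -> 0 < 1 - (p i)%:R^-1 :> R.
  move=> i_gt0; rewrite subr_gt0 invf_lt1 ?ltr0n ?ltr1n.
    exact/prime_gt1/(nth_prime_prime p_primes).
  exact/prime_gt0/(nth_prime_prime p_primes).
have E_gt0 N : 0 < E N.
  rewrite /E big_seq_cond prodr_gt0 // => i.
  by rewrite mem_index_iota andbT => /andP[/pfac].
have inv N : (n0 <= N)%N -> E n0 * Q' N <= E N * Q N.
  elim: N => [|N IHN]; first by rewrite /n0; lia.
  rewrite leq_eqVlt => /predU1P[<-|].
    by rewrite ler_pM2l // den_y_le_den_x.
  rewrite ltnS => n0N; have {}IHN := IHN n0N.
  have /andP[_ S_le] := cf_den_leS N y_ge1.
  have /andP[Q_ge _] := cf_den_leS N x_ge1.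
  have key : y N.+1 + 1 <= (1 - (p N.+1)%:R^-1) * x N.+1.
    have /andP[s1 _] := @sqrt2_bounds R.
    have [n1N N3] : (n1 <= N.+1)%N /\ (3 <= N.+1)%N by rewrite /n0 in n0N; lia.
    have p3 := ltn_trans N3 (nth_prime_gt p_increasing p_primes (ltn0Sn N)).
    have := n1P _ n1N; move: N3 p3; rewrite -!(ler_nat R) => N3 p3 a3.
    rewrite /x /y; move: (a N.+1)%:R (p N.+1)%:R N.+1%:R a3 N3 p3.
    move=> u w v u3 v3 w3.
    have -> : (1 - w^-1) * (u * (1 + w / v) * s) =
      u * (w / v) * s + u * s * (1 - v^-1 - w^-1).
      by field; apply/andP; split; lra.
    have v' : v^-1 <= 3^-1 by rewrite lef_pV2 ?posrE //; lra.
    have w' : w^-1 <= 3^-1 by rewrite lef_pV2 ?posrE //; lra.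
    rewrite lerD2l; have us : 3 <= u * s by nra.
    nra.
  apply: (@le_trans _ _ ((y N.+1 + 1) * (E n0 * Q' N))).
    by rewrite mulrCA ler_pM2l.
  apply: (@le_trans _ _ ((1 - (p N.+1)%:R^-1) * x N.+1 * (E N * Q N))).
    apply: ler_pM => //; first by rewrite addr_ge0 // ltW.
    by rewrite mulr_ge0 // ltW // cf_den_gt0.
  have -> : (1 - (p N.+1)%:R^-1) * x N.+1 * (E N * Q N) =
    E N * (1 - (p N.+1)%:R^-1) * (x N.+1 * Q N) by ring.
  have -> : E N.+1 = E N * (1 - (p N.+1)%:R^-1) by rewrite /E big_nat_recr.
  by apply: ler_wpM2l => //; rewrite mulr_ge0 // ltW // pfac.
have [N1 N1P] := euler_product_cvg0 p_increasing p_primes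
  (divr_gt0 (E_gt0 n0) B_gt0).
exists (maxn n0 N1) => N; rewrite geq_max => /andP[/inv leN /N1P leE].
have : E n0 * Q' N <= E n0 / B * Q N.
  by apply: le_trans leN _; rewrite ler_pM2r ?cf_den_gt0.
by rewrite -mulrA ler_pM2l // mulrC ler_pdivlMr // mulrC.
Qed.
Let x_rational n : x n.+1 = (a n.+1 * (n.+1 + p n.+1))%:R / n.+1%:R * s.
Proof. by rewrite /x natrM natrD; field; rewrite nat1r pnatr_eq0. Qed.

Let y_rational n : y n.+1 = (a n.+1 * p n.+1)%:R / n.+1%:R * s.
Proof. by rewrite /y natrM; field; rewrite nat1r pnatr_eq0. Qed.

Lemma a_le_y n : (a n.+1)%:R <= y n.+1.
Proof.
have /andP[s1 _] := @sqrt2_bounds R; have /andP[p1 _] := pn_bounds n.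
by rewrite /y -mulrA ler_peMr // mulr_ege1.
Qed.

(** The left side is the product of the bounds for a_(n+1) |theta| and for the
conjugate of theta.  Both n! and, apart from the a_i, each of Q_n and Q'_n are
compared with the primorial, which is at most 2^(2^n) and occurs to the sixth
power: hence the factor 64 = 2^6, while 50 = 2 * 5^2. *)
Lemma clearing_cost_le C n :
  6 * C%:R ^+ 2 * n`!%:R ^+ 4 * 2 ^+ n * (Q n * Q' n) <=
  ((6 * C ^ 2 * 50 * 64) ^ (2 ^ n) * (\prod_(1 <= i < n.+1) a i) ^ 2)%:R.
Proof.
have Q'_gt0 : 0 < Q' n by exact: cf_den_gt0.
have Q_gt0 : 0 < Q n by exact: cf_den_gt0.
set W := (\prod_(1 <= i < n.+1) p i)%N; set Ta := (\prod_(1 <= i < n.+1) a i)%N.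
apply: (@le_trans _ _ (6 * C%:R ^+ 2 * W%:R ^+ 4 * 2 ^+ n *
    (5 ^+ n * Ta%:R * W%:R) ^+ 2)).
  have le_W : n`!%:R <= W%:R :> R.
    by rewrite ler_nat; apply: factorial_le_primorial p_increasing p_primes n.
  apply: ler_pM;
    [by rewrite !mulr_ge0 ?exprn_ge0|by rewrite mulr_ge0 // ltW| |].
    apply: ler_wpM2r; first exact: exprn_ge0.
    apply: ler_wpM2l; first by rewrite mulr_ge0 // exprn_ge0.
    by apply: lerXn2r; rewrite ?nnegrE.
  rewrite [leRHS]expr2; apply: ler_pM;
    rewrite ?den_x_le_prod ?(ltW Q_gt0) ?(ltW Q'_gt0) //.
  exact: le_trans (den_y_le_den_x n) (den_x_le_prod n).
have -> : 6 * C%:R ^+ 2 * W%:R ^+ 4 * 2 ^+ n * (5 ^+ n * Ta%:R * W%:R) ^+ 2 =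
   (6 * C ^ 2 * 50 ^ n * W ^ 6 * Ta ^ 2)%:R :> R.
  have h50 : 50 = 2 * (5 * 5) :> R by ring.
  rewrite !natrM !natrX h50 !(exprMn n).
  by move: (5 ^+ n) (2 ^+ n) => w z; ring.
rewrite ler_nat leq_mul2r; apply/orP; right.
rewrite (expnMn _ 64) (expnMn _ 50); apply: leq_mul; first apply: leq_mul.
- case: (6 * C ^ 2)%N => [//|k].
  by apply: (@leq_pexp2l k.+1 1) => //; rewrite expn_gt0.
- by rewrite leq_exp2l // ltnW // ltn_expl.
- have -> : 64%N = (2 ^ 6)%N by [].
  rewrite -expnM mulnC expnM leq_exp2r //.
  exact: primorial_le p_increasing p_primes n.
Qed.

(** The number U + V s below is theta, the combination cleared of denominators.
The products e1 s and e2 s are odd under conjugation and e3 is even, so the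
conjugate of theta is again a combination of the same three nonnegative numbers,
with coefficients that are conjugates up to sign. *)
Lemma combination_vanishes (C N : nat) (u1 v1 u2 v2 u3 v3 : int) :
  (`|u1| + 2 * `|v1| <= C)%N -> (`|u2| + 2 * `|v2| <= C)%N ->
  (`|u3| + 2 * `|v3| <= C)%N ->
  ((6 * C ^ 2 * 50 * 64) ^ (2 ^ N) * (\prod_(1 <= i < N.+1) a i) ^ 2 <
    a N.+1)%N ->
  (u1%:~R + v1%:~R * s) * cfrac 0 x + (u2%:~R + v2%:~R * s) * cfrac 0 y
    + (u3%:~R + v3%:~R * s) = 0 ->
  (u1%:~R + v1%:~R * s) * fin_cfrac 0 x N +
    (u2%:~R + v2%:~R * s) * fin_cfrac 0 y N + (u3%:~R + v3%:~R * s) = 0.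
Proof.
have abs_le (u v : int) : (`|u| + 2 * `|v| <= C)%N ->
    `|u%:~R + v%:~R * s| <= C%:R /\ `|u%:~R - v%:~R * s| <= C%:R.
  rewrite -(ler_nat R) natrD natrM !natr_absz !intr_norm.
  have /andP[s1 s2] := @sqrt2_bounds R.
  have : `|v%:~R * s| <= 2 * `|v%:~R|.
    by rewrite normrM [`|s|]ger0_norm // [leRHS]mulrC; apply: ler_wpM2l.
  have := ler_normD (u%:~R : R) (v%:~R * s).
  have := ler_normB (u%:~R : R) (v%:~R * s).
  by move=> *; split; lra.
move=> /abs_le [] + + /abs_le [] + + /abs_le [] + + a_big.
set c1 := u1%:~R + v1%:~R * s; set c2 := u2%:~R + v2%:~R * s.
set c3 := u3%:~R + v3%:~R * s.
set d1 := u1%:~R - v1%:~R * s; set d2 := u2%:~R - v2%:~R * s.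
set d3 := u3%:~R - v3%:~R * s => c1C d1C c2C d2C c3C d3C rel.
rewrite !fin_cfrac_convergent // -/(P N) -/(Q N) -/(P' N) -/(Q' N).
have Q'_gt0 n : 0 < Q' n by exact: cf_den_gt0.
have Q_gt0 n : 0 < Q n by exact: cf_den_gt0.
set g := _ + c3.
pose D : R := N`!%:R; have D_gt0 : 0 < D by rewrite ltr0n fact_gt0.
have [q [k [qE kE]]] :=
  @convergent_integrality R (fun n => (a n * (n + p n))%N) x N x_rational.
have [r [l [rE lE]]] :=
  @convergent_integrality R (fun n => (a n * p n)%N) y N y_rational.
have spow : s ^+ odd N * s ^+ (~~ odd N) = s.
  by case: odd; rewrite /= ?mulr1 ?mul1r.
have e1E : D ^+ 2 * (P N * Q' N) = (k * r)%:R * s.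
  transitivity ((D * P N) * (D * Q' N)); first by ring.
  by rewrite kE rE natrM -[in RHS]spow; ring.
have e2E : D ^+ 2 * (P' N * Q N) = (l * q)%:R * s.
  transitivity ((D * P' N) * (D * Q N)); first by ring.
  by rewrite lE qE natrM -[in RHS]spow; ring.
have e3E : D ^+ 2 * (Q N * Q' N) = (q * r * (if odd N then 2 else 1))%:R.
  transitivity ((D * Q N) * (D * Q' N)); first by ring.
  rewrite qE rE !natrM; case: odd => /=; ring: (@sqr_sqrt2 R).
move: (k * r)%N (l * q)%N (q * r * _)%N e1E e2E e3E => e1 e2 e3 e1E e2E e3E.
have gE : D ^+ 2 * (Q N * Q' N) * g =
    c1 * (e1%:R * s) + c2 * (e2%:R * s) + c3 * e3%:R.
  rewrite -e1E -e2E -e3E /g; field; by rewrite !gt_eqF.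
pose U : int := 2 * (v1 * e1%:Z + v2 * e2%:Z) + u3 * e3%:Z.
pose V : int := u1 * e1%:Z + u2 * e2%:Z + v3 * e3%:Z.
have UVp : U%:~R + V%:~R * s = D ^+ 2 * (Q N * Q' N) * g.
  rewrite gE /U /V !(intrD, intrM) /c1 /c2 /c3; ring: (@sqr_sqrt2 R).
have UVm : U%:~R - V%:~R * s =
    - (d1 * (e1%:R * s)) - d2 * (e2%:R * s) + d3 * e3%:R.
  rewrite /U /V !(intrD, intrM) /d1 /d2 /d3; ring: (@sqr_sqrt2 R).
have DQQ'_gt0 : 0 < D ^+ 2 * (Q N * Q' N) by rewrite !mulr_gt0 // exprn_gt0.
suff : U%:~R + V%:~R * s = 0.
  by rewrite UVp => /eqP; rewrite mulf_eq0 gt_eqF //= => /eqP.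
apply: zsqrt2_small_eq0.
have conj_le : `|U%:~R - V%:~R * s| <= 3 * C%:R * (D ^+ 2 * (Q N * Q' N)).
  have le1 : e1%:R * s <= D ^+ 2 * (Q N * Q' N).
    rewrite -e1E ler_pM2l ?exprn_gt0 // ler_pM2r //.
    exact: cf_num_le_den x_ge1.
  have le2 : e2%:R * s <= D ^+ 2 * (Q N * Q' N).
    rewrite -e2E ler_pM2l ?exprn_gt0 // mulrC ler_pM2l //.
    exact: cf_num_le_den y_ge1.
  have f1 : `|d1 * (e1%:R * s)| <= C%:R * (D ^+ 2 * (Q N * Q' N)).
    by rewrite normrM ler_pM // ger0_norm // mulr_ge0.
  have f2 : `|d2 * (e2%:R * s)| <= C%:R * (D ^+ 2 * (Q N * Q' N)).
    by rewrite normrM ler_pM // ger0_norm // mulr_ge0.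
  have f3 : `|d3 * e3%:R| <= C%:R * (D ^+ 2 * (Q N * Q' N)).
    by rewrite normrM ler_pM // ger0_norm // e3E.
  rewrite UVm; move: f1 f2 f3; rewrite !ler_norml; lra.
have g_le : (a N.+1)%:R * `|U%:~R + V%:~R * s| <= 2 * C%:R * D ^+ 2 * 2 ^+ N.
  rewrite UVp normrM gtr0_norm //.
  have gapE : g =
      - (c1 * (cfrac 0 x - P N / Q N)) - c2 * (cfrac 0 y - P' N / Q' N).
    by rewrite /g; move: rel; lra.
  have /andP[_ ex] := cfrac_error N x_ge1.
  have /andP[_ ey] := cfrac_error N y_ge1.
  rewrite !fin_cfrac_convergent // -/(P N) -/(Q N) -/(P' N) -/(Q' N) in ex ey.
  have g_le : `|g| <= C%:R * (Q N * Q N.+1)^-1 + C%:R * (Q' N * Q' N.+1)^-1.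
    rewrite gapE; apply: le_trans (ler_normB _ _) _; rewrite normrN !normrM.
    by apply: lerD; apply: ler_pM.
  have a'_ge0 : 0 <= (a N.+1)%:R :> R by [].
  have Qstep : (a N.+1)%:R * Q' N <= Q N.+1.
    have /andP[+ _] := cf_den_leS N x_ge1; apply: le_trans.
    apply: ler_pM; rewrite ?den_y_le_den_x ?(ltW (Q'_gt0 N)) //.
    exact: le_trans (a_le_y N) (y_le_x N).
  have Sstep : (a N.+1)%:R * Q N <= 2 ^+ N * Q' N.+1.
    apply: (@le_trans _ _ ((a N.+1)%:R * (2 ^+ N * Q' N))).
      by apply: ler_wpM2l => //; apply: den_x_le_den_y.
    rewrite mulrCA ler_pM2l ?exprn_gt0 //.
    have /andP[+ _] := cf_den_leS N y_ge1; apply: le_trans.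
    by rewrite ler_pM2r // a_le_y.
  have D2_gt0 : 0 < D ^+ 2 by rewrite exprn_gt0.
  apply: (@le_trans _ _ (C%:R * D ^+ 2 * ((a N.+1)%:R * Q' N / Q N.+1 +
      (a N.+1)%:R * Q N / Q' N.+1))).
    have -> : C%:R * D ^+ 2 * ((a N.+1)%:R * Q' N / Q N.+1 +
        (a N.+1)%:R * Q N / Q' N.+1) =
      ((a N.+1)%:R * (D ^+ 2 * (Q N * Q' N))) *
        (C%:R * (Q N * Q N.+1)^-1 + C%:R * (Q' N * Q' N.+1)^-1).
      by field; rewrite !gt_eqF.
    by rewrite [leLHS]mulrA ler_wpM2l // mulr_ge0 // ltW.
  have -> : 2 * C%:R * D ^+ 2 * 2 ^+ N =
      C%:R * D ^+ 2 * (2 ^+ N + 2 ^+ N) by ring.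
  apply: ler_wpM2l; first by rewrite mulr_ge0 // ltW.
  apply: lerD; last by rewrite ler_pdivrMr.
  apply: (@le_trans _ _ 1); first by rewrite ler_pdivrMr // mul1r.
  by rewrite exprn_ege1 //; lra.
have size_le := clearing_cost_le C N.
have a'_gt0 : 0 < (a N.+1)%:R :> R by apply: lt_le_trans (aR_ge1 N).
rewrite -(ltr_pM2l a'_gt0) mulr1 mulrA.
apply: (@le_lt_trans _ _ (6 * C%:R ^+ 2 * D ^+ 4 * 2 ^+ N *
    (Q N * Q' N))); last first.
  by apply: le_lt_trans size_le _; rewrite ltr_nat.
have -> : 6 * C%:R ^+ 2 * D ^+ 4 * 2 ^+ N * (Q N * Q' N) =
  (2 * C%:R * D ^+ 2 * 2 ^+ N) * (3 * C%:R * (D ^+ 2 * (Q N * Q' N))) by ring.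
by apply: ler_pM => //; apply: mulr_ge0.
Qed.

(** The same relation would hold between the errors of the convergents for
arbitrarily large N, while their quotient is unbounded. *)
Lemma sqrt2_lin_indep (c1 c2 c3 : R) :
  rat_adjoin s c1 -> rat_adjoin s c2 -> rat_adjoin s c3 ->
  c1 * cfrac 0 x + c2 * cfrac 0 y + c3 = 0 -> [/\ c1 = 0, c2 = 0 & c3 = 0].
Proof.
move=> /rat_adjoin_sqrt2[d1 [u1 [v1 [d1_neq0 c1E]]]].
move=> /rat_adjoin_sqrt2[d2 [u2 [v2 [d2_neq0 c2E]]]].
move=> /rat_adjoin_sqrt2[d3 [u3 [v3 [d3_neq0 c3E]]]] rel.
pose d : R := d1%:~R * d2%:~R * d3%:~R.
have d_neq0 : d != 0 by rewrite !mulf_neq0 // intr_eq0.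
pose C := maxn (`|d2 * d3 * u1| + 2 * `|d2 * d3 * v1|)
  (maxn (`|d1 * d3 * u2| + 2 * `|d1 * d3 * v2|)
        (`|d1 * d2 * u3| + 2 * `|d1 * d2 * v3|)).
have scale (e1 e2 e3 u v : int) (c : R) : e1%:~R * c = u%:~R + v%:~R * s ->
  e1%:~R * e2%:~R * e3%:~R * c = (e2 * e3 * u)%:~R + (e2 * e3 * v)%:~R * s.
  move=> cE; rewrite !intrM.
  transitivity (e2%:~R * e3%:~R * (e1%:~R * c)); first by ring.
  by rewrite cE; ring.
have dc1 := scale _ d2 d3 _ _ _ c1E; have dc2 := scale _ d1 d3 _ _ _ c2E.
have dc3 := scale _ d1 d2 _ _ _ c3E.
have vanish N :
  ((6 * C ^ 2 * 50 * 64) ^ (2 ^ N) * (\prod_(1 <= i < N.+1) a i) ^ 2 <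
    a N.+1)%N ->
  c1 * (cfrac 0 x - fin_cfrac 0 x N) = - (c2 * (cfrac 0 y - fin_cfrac 0 y N)).
  move=> a_big.
  have := @combination_vanishes C N (d2 * d3 * u1) (d2 * d3 * v1)
    (d1 * d3 * u2) (d1 * d3 * v2) (d1 * d2 * u3) (d1 * d2 * v3).
  rewrite -dc1 -dc2 -dc3 !leq_max !leqnn !orbT /= => /(_ isT isT isT a_big) van.
  have : d * (c1 * fin_cfrac 0 x N + c2 * fin_cfrac 0 y N + c3) = 0.
    etransitivity; last apply: van; first by rewrite /d; ring.
    transitivity (d * (c1 * cfrac 0 x + c2 * cfrac 0 y + c3)).
      by rewrite /d; ring.
    by rewrite rel mulr0.
  move/eqP; rewrite mulf_eq0 (negPf d_neq0) /= => /eqP; move: rel; lra.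
have c2_eq0 : c2 = 0.
  apply/eqP; apply: contraT => c2_neq0.
  pose kappa := `|c1 / c2|; have kappa_ge0 : 0 <= kappa by exact: normr_ge0.
  (* The bound 1 + 2 kappa is chosen because its square exceeds 2 kappa. *)
  have [|N0 N0P] := @den_ratio_unbounded (1 + 2 * kappa); first by lra.
  have [N N0N /vanish] := growth_gap a_gt0 a_growth (6 * C ^ 2 * 50 * 64) N0.
  have leN := N0P N N0N; have leSN := N0P N.+1 (leqW N0N).
  move=> errE.
  have Q'_gt0 n : 0 < Q' n by exact: cf_den_gt0.
  have Q_gt0 n : 0 < Q n by exact: cf_den_gt0.
  have /andP[_ ex] := cfrac_error N x_ge1.
  have /andP[ey _] := cfrac_error N y_ge1.
  have err : `|cfrac 0 y - fin_cfrac 0 y N| =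
      kappa * `|cfrac 0 x - fin_cfrac 0 x N|.
    rewrite /kappa -normrM -[in RHS]mulrA [_^-1 * _]mulrC mulrA errE mulNr.
    by rewrite normrN [c2 * _]mulrC mulfK.
  have gap_le : cf_gap y N <= 2 * kappa * cf_gap x N.
    have := ler_wpM2l kappa_ge0 ex; rewrite -err; move: ey; lra.
  have : Q N * Q N.+1 <= 2 * kappa * (Q' N * Q' N.+1).
    move: gap_le; rewrite /cf_gap -/(Q' N) -/(Q' N.+1) -/(Q N) -/(Q N.+1).
    by rewrite ler_pdivlMr ?mulr_gt0 // mulrC ler_pdivrMr ?mulr_gt0.
  have : (1 + 2 * kappa) * Q' N * ((1 + 2 * kappa) * Q' N.+1) <= Q N * Q N.+1.
    by apply: ler_pM => //; rewrite mulr_ge0 ?ltW //; lra.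
  have := mulr_gt0 (Q'_gt0 N) (Q'_gt0 N.+1); rewrite mulrACA.
  by move: (Q' N * Q' N.+1) => z; nra.
have c1_eq0 : c1 = 0.
  have [N _ /vanish] := growth_gap a_gt0 a_growth (6 * C ^ 2 * 50 * 64) 0.
  rewrite c2_eq0 mul0r oppr0 => /eqP; rewrite mulf_eq0 => /orP[/eqP//|].
  have /andP[+ _] := cfrac_error N x_ge1; rewrite -normr_eq0 => + /eqP e0.
  by rewrite e0; have := cf_gap_gt0 N x_gt0; lra.
by split=> //; move: rel; rewrite c1_eq0 c2_eq0 !mul0r !add0r.
Qed.
End Main.

Theorem theorem1 (R : realType) (a p : nat -> nat)
  (a_gt0 : forall n, (1 <= n)%N -> (0 < a n)%N)
  (a_nondecreasing : forall m n, (1 <= m <= n)%N -> (a m <= a n)%N)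
  (a_growth : ((a n)%:R : R) `^ (3 ^+ n)^-1 @[n --> \oo] --> +oo)
  (p_increasing : forall m n, (1 <= m < n)%N -> (p m < p n)%N)
  (p_primes : forall q, prime q <-> exists2 n, (1 <= n)%N & p n = q) :
  let alpha : R := cfrac 0 (fun n =>
    (a n)%:R * (1 + (p n)%:R / n%:R) * Num.sqrt 2) in
  let beta : R := cfrac 0 (fun n =>
    (a n)%:R * ((p n)%:R / n%:R) * Num.sqrt 2) in
  lin_indep (rat_adjoin (Num.sqrt 2)) [tuple alpha; beta; 1] /\
  lin_indep (@rationals R) [tuple alpha; beta; 1].
Proof.
move=> alpha beta.
have indep : lin_indep (rat_adjoin (Num.sqrt 2)) [tuple alpha; beta; 1].
  move=> c Kc; rewrite !big_ord_recl big_ord0 !(tnth_nth 0) /=.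
  rewrite mulr1 addr0 addrA.
  move=> /(sqrt2_lin_indep a_gt0 a_growth p_increasing p_primes
    (Kc _) (Kc _) (Kc _)).
  move=> [c0 c1 c2] i.
  case: i => [[|[|[|//]]] i_lt].
  - by rewrite -[RHS]c0; congr c; apply: val_inj.
  - by rewrite -[RHS]c1; congr c; apply: val_inj.
  - by rewrite -[RHS]c2; congr c; apply: val_inj.
split=> // c Qc; apply: indep => i.
exact: rationals_sub_adjoin.
Qed.
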